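(* Let $\mathcal{H}$ be a complex Hilbert space. The map $T\mapsto T'=T(T^*T)^{-1}$ (Cauchy dual) is a bijection from the set of all $\Delta_T$-regular concave operators $T\in\mathcal{B}(\mathcal{H})$ onto the set of all left invertible operators $C\in\mathcal{B}(\mathcal{H})$ which are $2$-hypercontractions, are $D_C^2$-regular, and satisfy $\|P_{\mathcal{D}_C}Ch\|\le\|C^*Ch\|$ for all $h\in\mathcal{D}_C$.
   Context: $\Delta_T=T^*T-I$. $T$ is concave if $T^{*2}T^2-2T^*T+I\le 0$; such $T$ is expansive, hence left invertible, so $T^*T$ is invertible and the Cauchy dual $T'=T(T^*T)^{-1}$ is defined. For a positive operator $A$, an operator $T$ is $A$-regular if $AT=A^{1/2}TA^{1/2}$. An operator $C$ is a $2$-hypercontraction if $I-C^*C\ge0$ and $I-2C^*C+C^{*2}C^2\ge 0$. For a contraction $C$, $D_C=(I-C^*C)^{1/2}$, $\mathcal{D}_C=\overline{\mathcal{R}(D_C)}$, and $D_C^2$-regularity means $D_C^2C=D_CCD_C$. $P_{\mathcal{M}}$ is the orthogonal projection onto $\mathcal{M}$. *)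

(* Defs.v *)
(* complex Hilbert spaces over C := R[i], R : realType. *)
From HB Require Import structures.
From mathcomp Require Import all_boot all_order all_algebra.
From mathcomp Require Import complex.
From mathcomp Require Import reals.
From Stdlib Require Import ClassicalEpsilon.

Set Implicit Arguments.
Unset Strict Implicit.
Unset Printing Implicit Defensive.

Import Order.TTheory GRing.Theory Num.Theory.
Local Open Scope ring_scope.

Section Hilbert.
Variables (R : realType) (V : lmodType R[i]) (ip : V -> V -> R[i]).

(* ip is a complex inner product: linear in the first argument,
   conjugate symmetric, positive definite. *)
Definition is_inner_product : Prop :=
  [/\ (forall (a : R[i]) x y z, ip (a *: x + y) z = a * ip x z + ip y z),
      (forall x y, ip y x = (ip x y)^*),
      (forall x, 0 <= ip x x) &
      (forall x, ip x x = 0 -> x = 0)].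

(* the induced norm ||x|| = <x,x>^(1/2) (a nonnegative real, inside C) *)
Definition hnorm (x : V) : R[i] := sqrtC (ip x x).

(* completeness of V w.r.t. the induced norm *)
Definition hcomplete : Prop :=
  forall u : nat -> V,
    (forall e : R[i], 0 < e -> exists N, forall m n, (N <= m)%N -> (N <= n)%N ->
        hnorm (u m - u n) < e) ->
    exists x, forall e : R[i], 0 < e -> exists N, forall n, (N <= n)%N ->
        hnorm (u n - x) < e.

(* Hilbert space: inner product space complete in its norm *)
Definition hilbert : Prop := is_inner_product /\ hcomplete.

(* bounded linear operators B(H) *)
Definition bop (T : V -> V) : Prop :=
  (forall (a : R[i]) x y, T (a *: x + y) = a *: T x + T y) /\
  (exists M : R[i], forall x, hnorm (T x) <= M * hnorm x).

(* the adjoint T^* *)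
Definition is_adjoint (T S : V -> V) : Prop :=
  forall x y, ip (T x) y = ip x (S y).
Definition adj (T : V -> V) : V -> V :=
  epsilon (inhabits id) (fun S => is_adjoint T S).

(* positive operators and the operator order A <= B *)
Definition opnonneg (A : V -> V) : Prop := forall x, 0 <= ip (A x) x.
Definition ople (A B : V -> V) : Prop := opnonneg (fun x => B x - A x).

(* the (two-sided) inverse of an invertible operator *)
Definition opinv (A : V -> V) : V -> V :=
  epsilon (inhabits id)
    (fun B => bop B /\ forall x, B (A x) = x /\ A (B x) = x).

(* the positive square root A^{1/2} of a positive operator A *)
Definition opsqrt (A : V -> V) : V -> V :=
  epsilon (inhabits id)
    (fun B => bop B /\ opnonneg B /\ forall x, B (B x) = A x).

(* orthogonal projection onto a closed subspace M *)
Definition opproj (M : V -> Prop) : V -> V :=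
  epsilon (inhabits id)
    (fun P => forall x, M (P x) /\ forall y, M y -> ip (x - P x) y = 0).

(* closure of the range of an operator D *)
Definition closure_range (D : V -> V) (y : V) : Prop :=
  forall e : R[i], 0 < e -> exists x, hnorm (y - D x) < e.

(* Delta_T = T^*T - I *)
Definition Delta (T : V -> V) : V -> V := fun x => adj T (T x) - x.

(* concave: T^{*2}T^2 - 2T^*T + I <= 0 *)
Definition concave (T : V -> V) : Prop :=
  ople (fun x => adj T (adj T (T (T x))) - 2%:R *: adj T (T x) + x) (fun _ => 0).

(* A-regular: A T = A^{1/2} T A^{1/2} *)
Definition regular (A T : V -> V) : Prop :=
  forall x, A (T x) = opsqrt A (T (opsqrt A x)).

(* Cauchy dual T' = T (T^*T)^{-1} *)
Definition cdual (T : V -> V) : V -> V := T \o opinv (fun x => adj T (T x)).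

(* left invertibility in B(H) *)
Definition left_invertible (C : V -> V) : Prop :=
  exists L, bop L /\ forall x, L (C x) = x.

(* 2-hypercontraction *)
Definition hypercontraction2 (C : V -> V) : Prop :=
  opnonneg (fun x => x - adj C (C x)) /\
  opnonneg (fun x => x - 2%:R *: adj C (C x) + adj C (adj C (C (C x)))).

(* D_C = (I - C^*C)^{1/2} *)
Definition defect (C : V -> V) : V -> V := opsqrt (fun x => x - adj C (C x)).

(* D_C^2-regularity: D_C^2 C = D_C C D_C *)
Definition defect_regular (C : V -> V) : Prop :=
  forall x, defect C (defect C (C x)) = defect C (C (defect C x)).

End Hilbert.

(* Main.v *)
Require Import Defs.
From HB Require Import structures.
From mathcomp Require Import all_boot all_order all_algebra.
From mathcomp Require Import complex.
From mathcomp Require Import reals.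
From mathcomp Require Import boolp classical_sets.
From mathcomp Require Import ring lra.
From Stdlib Require Import ClassicalEpsilon.

(* The real part of the inner product makes H a real Hilbert space; a complex-
   linear operator has the same adjoint, positivity and positive square root
   there, and square roots commute with whatever commutes with the operator.

   Let C be the Cauchy dual of T, A = T^*T and B = C^*C = A^{-1}, so that
   T = C A and the duality is an involution.  With Q = Delta_T^{1/2} and D = D_C
   one has D = Q B^{1/2}.  Regularity of T says that Q T commutes with Q, and
   regularity of C that D C commutes with D; since D C = B^{1/2} (Q T) B, each
   implies the other.  Concavity of T reads |Q T x| <= |Q x|, which the same
   factorization turns into |D C x| <= |B D x|.  Finally D C D = D^2 C gives
   P_{D_C} C D = D C, so the latter inequality is the norm condition on the
   range of D, hence on its closure, and it implies the hypercontractivity of C. *)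

Set Implicit Arguments.
Unset Strict Implicit.
Unset Printing Implicit Defensive.

Import Order.TTheory GRing.Theory Num.Theory.
Local Open Scope ring_scope.

(** * Positive semidefinite forms and the Cauchy-Schwarz inequality *)

Section RealHilbert.
Variables (R : realType) (V : lmodType R).
Implicit Types (x y z : V) (T S A B F G K : V -> V) (b : V -> V -> R).

(** Definiteness is left out so that Cauchy-Schwarz also applies to the form [<<A x, y>>] of a
    positive operator [A]. *)
Definition psd_form b : Prop :=
  [/\ forall (a : R) x y z, b (a *: x + y) z = a * b x z + b y z,
      forall x y, b y x = b x y & forall x, 0 <= b x x].

(** The discriminant criterion, in a form that covers the degenerate leading coefficient [r = 0]
    too. *)
Lemma discr_le (p q r : R) : 0 <= r ->
  (forall t, 0 <= p - 2 * t * q + t ^+ 2 * r) -> q ^+ 2 <= p * r.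
Proof.
rewrite le_eqVlt => /orP[/eqP r0|r0] h.
  rewrite -r0 mulr0; case: (eqVneq q 0) => [->|q0]; first by rewrite expr0n.
  (* For [r = 0] this choice of [t] gives the polynomial the value -1. *)
  have := h ((p + 1) / (2 * q)); rewrite -r0 mulr0 addr0.
  have -> : 2 * ((p + 1) / (2 * q)) * q = p + 1 by field.
  lra.
(* The minimizer of the quadratic polynomial. *)
have := h (q / r).
have -> : p - 2 * (q / r) * q + (q / r) ^+ 2 * r = (p * r - q ^+ 2) / r.
  by field; rewrite gt_eqF.
by rewrite pmulr_lge0 ?invr_gt0 // subr_ge0.
Qed.

Section PsdForm.
Variable b : V -> V -> R.
Hypothesis hb : psd_form b.

Lemma psd_sym x y : b x y = b y x. Proof. by case: hb. Qed.

Lemma psd_ge0 x : 0 <= b x x. Proof. by case: hb. Qed.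

Lemma psdDl x y z : b (x + y) z = b x z + b y z.
Proof. by case: hb => h _ _; rewrite -[x]scale1r h mul1r scale1r. Qed.

Lemma psd0l z : b 0 z = 0.
Proof. by have := psdDl 0 0 z; rewrite addr0; lra. Qed.

Lemma psdZl a x z : b (a *: x) z = a * b x z.
Proof. by case: hb => h _ _; rewrite -[a *: x]addr0 h psd0l addr0. Qed.

Lemma psdNl x z : b (- x) z = - b x z.
Proof. by rewrite -scaleN1r psdZl mulN1r. Qed.

Lemma psdDr x y z : b z (x + y) = b z x + b z y.
Proof. by rewrite ![b z _]psd_sym psdDl. Qed.

Lemma psd0r z : b z 0 = 0. Proof. by rewrite psd_sym psd0l. Qed.

Lemma psdZr a x z : b z (a *: x) = a * b z x.
Proof. by rewrite ![b z _]psd_sym psdZl. Qed.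

Lemma psdNr x z : b z (- x) = - b z x.
Proof. by rewrite ![b z _]psd_sym psdNl. Qed.

Definition psdE := (psdDl, psdDr, psdZl, psdZr, psdNl, psdNr, psd0l, psd0r).

Lemma psd_CS x y : b x y ^+ 2 <= b x x * b y y.
Proof.
apply: discr_le => [|t]; first exact: psd_ge0.
have := psd_ge0 (x - t *: y); rewrite !psdE (psd_sym y x); lra.
Qed.

End PsdForm.

(** * The norm, and limits with explicit rates *)

Definition nrm b x := Num.sqrt (b x x).

Definition real_hilbert b : Prop :=
  [/\ psd_form b, forall x, b x x = 0 -> x = 0 &
    forall u : nat -> V,
      (forall e : R, 0 < e -> exists N, forall m n, (N <= m)%N -> (N <= n)%N ->
         nrm b (u m - u n) < e) ->
      exists x, forall e : R, 0 < e -> exists N, forall n, (N <= n)%N ->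
         nrm b (u n - x) < e].

Variable dot : V -> V -> R.
Hypothesis hilb : real_hilbert dot.

Local Notation "<< x , y >>" := (dot x y) (format "<< x ,  y >>").
Local Notation nm := (nrm dot).

Let hdot : psd_form dot. Proof. by case: hilb. Qed.

Definition dotE := (psdE hdot).

Lemma dot_eq0 x : <<x, x>> = 0 -> x = 0. Proof. by case: hilb => _ h _; apply: h. Qed.

Lemma dot_ext x y : (forall z, <<x, z>> = <<y, z>>) -> x = y.
Proof.
move=> h; apply/eqP; rewrite -subr_eq0; apply/eqP/dot_eq0.
by rewrite (psdDl hdot) (psdNl hdot) h subrr.
Qed.

Lemma nrm_ge0 x : 0 <= nm x. Proof. exact: sqrtr_ge0. Qed.

Lemma nrm_sqr x : nm x ^+ 2 = <<x, x>>.
Proof. by rewrite sqr_sqrtr // psd_ge0. Qed.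

Lemma nrm0 : nm 0 = 0.
Proof. by rewrite /nrm dotE sqrtr0. Qed.

Lemma nrm_eq0 x : nm x <= 0 -> x = 0.
Proof.
move=> h; apply: dot_eq0; rewrite -nrm_sqr.
have -> : nm x = 0 by apply/eqP; rewrite eq_le h nrm_ge0.
by rewrite expr0n.
Qed.

Lemma nrmZ a x : nm (a *: x) = `|a| * nm x.
Proof. by rewrite /nrm !dotE mulrA -expr2 sqrtrM ?sqr_ge0 // sqrtr_sqr. Qed.

Lemma nrmN x : nm (- x) = nm x.
Proof. by rewrite -scaleN1r nrmZ normrN1 mul1r. Qed.

Lemma nrmBC x y : nm (x - y) = nm (y - x).
Proof. by rewrite -nrmN opprB. Qed.

Lemma nrm_le_sqr x y : (nm x <= nm y) = (<<x, x>> <= <<y, y>>).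
Proof. by rewrite -!nrm_sqr ler_pXn2r // ?nnegrE ?nrm_ge0. Qed.

Lemma ler_sqr_nneg (a c : R) : 0 <= c -> a ^+ 2 <= c ^+ 2 -> a <= c.
Proof. by move=> c0 h; rewrite leNgt; apply/negP => ca; nra. Qed.

Lemma dot_le x y : <<x, y>> <= nm x * nm y.
Proof.
apply: ler_sqr_nneg; first by rewrite mulr_ge0 ?nrm_ge0.
by rewrite exprMn !nrm_sqr psd_CS.
Qed.

Lemma dot_le_abs x y : `|<<x, y>>| <= nm x * nm y.
Proof. by rewrite ler_norml dot_le lerNl -(psdNl hdot) -(nrmN x) dot_le. Qed.

Lemma nrmD x y : nm (x + y) <= nm x + nm y.
Proof.
apply: ler_sqr_nneg; first by rewrite addr_ge0 ?nrm_ge0.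
rewrite nrm_sqr !dotE (psd_sym hdot y x) sqrrD !nrm_sqr.
have := dot_le x y; lra.
Qed.

Lemma nrm_tri y x z : nm (x - z) <= nm (x - y) + nm (y - z).
Proof. by have := nrmD (x - y) (y - z); rewrite addrA subrK. Qed.

(** The common rate of convergence: limits below are controlled by bounds [K * eps n] with an
    explicit [K]. *)
Definition eps (n : nat) : R := n.+1%:R^-1.

Lemma eps_gt0 n : 0 < eps n. Proof. by rewrite invr_gt0 ltr0n. Qed.

Lemma eps0 : eps 0 = 1. Proof. exact: invr1. Qed.

Lemma eps_le m n : (m <= n)%N -> eps n <= eps m.
Proof. by move=> mn; rewrite lef_pV2 ?posrE ?ltr0n // ler_nat. Qed.

Lemma eps_small (e K : R) : 0 <= K -> 0 < e ->
  exists N, forall n, (N <= n)%N -> K * eps n < e.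
Proof.
move=> K0 e0; exists (Num.bound (K / e)) => n Nn.
have := archi_boundP (divr_ge0 K0 (ltW e0)).
rewrite ltr_pdivrMr // => h; rewrite ltr_pdivrMr ?ltr0n // mulrC.
apply: lt_le_trans h _; rewrite ler_pM2r // ler_nat; exact: leqW.
Qed.

Lemma eps_squeeze (a K : R) : (forall n, a <= K * eps n) -> a <= 0.
Proof.
move=> h; rewrite leNgt; apply/negP => a0.
have K0 : 0 <= K by have := h 0%N; rewrite eps0 mulr1; lra.
have [N hN] := eps_small K0 a0; by have := hN N (leqnn N); rewrite ltNge h.
Qed.

(** The limit inherits the rate of the Cauchy bound, so later estimates need no further choice of
    indices. *)
Lemma complete_eps (K : R) (u : nat -> V) :
  (forall m n, nm (u m - u n) <= K * eps m + K * eps n) ->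
  exists l, forall n, nm (u n - l) <= K * eps n.
Proof.
move=> h; case: hilb => _ _ hc.
have K0 : 0 <= K.
  by have := h 0%N 0%N; rewrite subrr nrm0 eps0 mulr1; lra.
have [|l hl] := hc u.
  move=> e e0; have [N hN] := @eps_small (e / 2) K K0 ltac:(lra).
  exists N => m n /hN hm /hN hn; have := h m n; lra.
exists l => n; rewrite -subr_le0; apply: (@eps_squeeze _ (K + 1)) => m.
(* Passing through an index [k] beyond [N] and [m] bounds the distance by
   [K * eps n + (K + 1) * eps m], with [m] arbitrary. *)
have [N hN] := hl (eps m) (eps_gt0 m).
pose k := maxn N m.
have := hN k (leq_maxl _ _); have := h n k; have := nrm_tri (u k) (u n) l.
have : K * eps k <= K * eps m.
  by rewrite ler_wpM2l // eps_le // leq_maxr.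
lra.
Qed.

(** * Bounded linear operators *)

Definition lin T : Prop := forall a x y, T (a *: x + y) = a *: T x + T y.

Section Lin.
Variable T : V -> V.
Hypothesis hT : lin T.

Lemma linD x y : T (x + y) = T x + T y.
Proof. by rewrite -[x]scale1r hT !scale1r. Qed.

Lemma lin0 : T 0 = 0.
Proof. by apply: (@addrI _ (T 0)); rewrite -linD !addr0. Qed.

Lemma linZ a x : T (a *: x) = a *: T x.
Proof. by rewrite -[a *: x]addr0 hT lin0 addr0. Qed.

Lemma linN x : T (- x) = - T x.
Proof. by rewrite -scaleN1r linZ scaleN1r. Qed.

Lemma linB x y : T (x - y) = T x - T y.
Proof. by rewrite linD linN. Qed.

End Lin.

Definition bounded_linear T : Prop :=
  lin T /\ exists M, forall x, nm (T x) <= M * nm x.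

Lemma bounded_linear_gt0 T : bounded_linear T ->
  exists2 M, 0 < M & forall x, nm (T x) <= M * nm x.
Proof.
case=> _ [M hM]; exists (`|M| + 1) => [|x]; first by rewrite ltr_wpDl.
apply: le_trans (hM x) _; rewrite ler_wpM2r ?nrm_ge0 //.
by have := ler_norm M; lra.
Qed.

Lemma bounded_linear_comp T S :
  bounded_linear T -> bounded_linear S -> bounded_linear (T \o S).
Proof.
move=> hT hS; have [M M0 hM] := bounded_linear_gt0 hT.
case: hT hS => lT _ [lS [N hN]]; split; first by move=> a x y /=; rewrite lS lT.
exists (M * N) => x /=; apply: le_trans (hM _) _.
by rewrite -mulrA ler_wpM2l // ltW.
Qed.

Lemma bounded_linearZ a : bounded_linear ( *:%R a).
Proof.
split; last by exists `|a| => x; rewrite nrmZ.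
by move=> c x y; rewrite scalerDr !scalerA mulrC.
Qed.

Lemma bounded_linear_id : bounded_linear id.
Proof. by split=> //; exists 1 => x; rewrite mul1r. Qed.

Lemma bounded_linearD T S : bounded_linear T -> bounded_linear S ->
  bounded_linear (fun x => T x + S x).
Proof.
move=> [lT [M hM]] [lS [N hN]]; split.
  by move=> a x y; rewrite lT lS scalerDr addrACA.
by exists (M + N) => x; have := nrmD (T x) (S x); have := hM x; have := hN x; lra.
Qed.

Lemma bounded_linearB T S : bounded_linear T -> bounded_linear S ->
  bounded_linear (fun x => T x - S x).
Proof.
move=> hT hS; apply: bounded_linearD => //; split; first last.
  by case: hS => _ [M hM]; exists M => x; rewrite nrmN.
by case: hS => lS _ a x y; rewrite lS opprD scalerN.
Qed.

(** * Orthogonal projection, Riesz representation and adjoints *)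

Definition subspace (M : V -> Prop) : Prop :=
  M 0 /\ forall a x y, M x -> M y -> M (a *: x + y).

Definition closed_set (M : V -> Prop) : Prop :=
  forall y, (forall e, 0 < e -> exists2 m, M m & nm (y - m) < e) -> M y.

(** A minimizing sequence for the distance is almost orthogonal to [M]; this alone makes it Cauchy
    and makes the residual of its limit orthogonal. *)
Lemma projection_exists (M : V -> Prop) x : subspace M -> closed_set M ->
  exists2 p, M p & forall y, M y -> <<x - p, y>> = 0.
Proof.
move=> [M0 MD] Mcl.
pose E : set R := [set r | exists2 m, M m & r = <<x - m, x - m>>]%classic.
have Elb : has_lbound E by exists 0 => _ [m _ ->]; apply: psd_ge0.
have Einf : has_inf E by split=> //; exists <<x - 0, x - 0>>; exists 0.
(* The excess over the infimum is squared because [E] holds squared distances; this makes the rate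
   below linear in [eps n]. *)
have /boolp.choice[m hm] : forall n,
    exists m, M m /\ <<x - m, x - m>> < inf E + eps n ^+ 2.
  move=> n; have [_ [m Mm ->] lt_m] := inf_adherent (exprn_gt0 2 (eps_gt0 n)) Einf.
  by exists m.
(* Moving [m n] by [t *: y] cannot go below the infimum, so a quadratic in [t] with constant term
   [eps n ^+ 2] is nonnegative. *)
have orth n y : M y -> `|<<x - m n, y>>| <= eps n * nm y.
  move=> My; have [Mm lt_m] := hm n.
  apply: ler_sqr_nneg; first by rewrite mulr_ge0 ?nrm_ge0 // ltW ?eps_gt0.
  rewrite real_normK ?num_real // exprMn nrm_sqr.
  apply: discr_le => [|t]; first exact: psd_ge0.
  have : inf E <= <<x - (t *: y + m n), x - (t *: y + m n)>>.
    by apply: ge_inf => //; exists (t *: y + m n) => //; apply: MD.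
  have -> : x - (t *: y + m n) = (x - m n) - t *: y by rewrite opprD addrA addrAC.
  move: (x - m n) lt_m => w lt_m.
  by rewrite !dotE (psd_sym hdot y w); lra.
have [|p hp] := @complete_eps 1 m.
  move=> i j; rewrite !mul1r; set w := m i - m j.
  have Mw : M w by rewrite /w addrC -scaleN1r; apply: MD; [case: (hm j) | case: (hm i)].
  have := orth i _ Mw; have := orth j _ Mw; rewrite !ler_norml.
  move=> /andP[_ hj] /andP[hi _].
  (* As [w] lies in [M], almost orthogonality of both residuals applies to [w] itself. *)
  have : nm w ^+ 2 <= (eps i + eps j) * nm w.
    have -> : nm w ^+ 2 = <<x - m j, w>> - <<x - m i, w>>.
      by rewrite nrm_sqr {1}/w !dotE; ring.
    lra.
  have := nrm_ge0 w; rewrite le_eqVlt => /orP[/eqP<- _|w0].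
    by rewrite addr_ge0 // ltW ?eps_gt0.
  by rewrite expr2 ler_pM2r.
exists p.
  apply: Mcl => e e0; have [N hN] := eps_small ler01 e0.
  exists (m N); first by case: (hm N).
  by rewrite nrmBC; apply: le_lt_trans (hp N) (hN N _).
move=> y My; apply/eqP; rewrite -normr_le0.
apply: (@eps_squeeze _ (2 * nm y)) => n.
have -> : x - p = (x - m n) + (m n - p) by rewrite addrA subrK.
rewrite (psdDl hdot); apply: le_trans (ler_normD _ _) _.
have := orth n _ My; have := dot_le_abs (m n - p) y.
have : nm (m n - p) * nm y <= 1 * eps n * nm y by rewrite ler_wpM2r ?nrm_ge0.
lra.
Qed.

(** Boundedness closes the kernel; projecting a vector outside it leaves a nonzero [w] orthogonal to
    the kernel, and a multiple of [w] represents [f]. *)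
Lemma riesz (f : V -> R) (M : R) :
  (forall a x y, f (a *: x + y) = a * f x + f y) ->
  (forall x, `|f x| <= M * nm x) -> exists z, forall x, f x = <<x, z>>.
Proof.
move=> flin fM.
have fD x y : f (x + y) = f x + f y by rewrite -[x]scale1r flin mul1r scale1r.
have f0 : f 0 = 0 by have := fD 0 0; rewrite addr0; lra.
have fZ a x : f (a *: x) = a * f x by rewrite -[a *: x]addr0 flin f0 addr0.
have fB x y : f (x - y) = f x - f y by rewrite -scaleN1r fD fZ mulN1r.
have [h|/existsNP[x0 /eqP fx0]] := pselect (forall x, f x = 0).
  by exists 0 => x; rewrite h dotE.
have ksub : subspace (fun x => f x = 0).
  by split=> // a x y hx hy; rewrite flin hx hy mulr0 addr0.
have kcl : closed_set (fun x => f x = 0).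
  move=> y hy; apply/eqP; rewrite -normr_le0.
  apply: (@eps_squeeze _ `|M|) => n.
  have [m hm lt_m] := hy _ (eps_gt0 n).
  have -> : f y = f (y - m) by rewrite fB hm subr0.
  apply: le_trans (fM _) _; apply: le_trans (ler_wpM2r (nrm_ge0 _) (ler_norm M)) _.
  by rewrite ler_wpM2l // ltW.
have [p fp orth] := projection_exists x0 ksub kcl.
set w := x0 - p in orth.
have fw : f w != 0 by rewrite /w fB fp subr0.
have w0 : <<w, w>> != 0.
  by apply: contra_neq fw => /dot_eq0 ->.
clearbody w; exists ((f w / <<w, w>>) *: w) => x.
have := orth (x - (f x / f w) *: w); rewrite fB fZ divfK // subrr => /(_ erefl).
rewrite !dotE (psd_sym hdot x w) => h.
have -> : <<w, x>> = f x / f w * <<w, w>> by lra.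
by field; rewrite fw w0.
Qed.

Definition adjoint T S : Prop := forall x y, <<T x, y>> = <<x, S y>>.

Lemma adjoint_exists T : bounded_linear T -> exists S, adjoint T S.
Proof.
move=> hT; have [M M0 hM] := bounded_linear_gt0 hT.
have lT := hT.1.
have /boolp.choice[S hS] : forall y, exists z, forall x, <<T x, y>> = <<x, z>>.
  move=> y; apply: (@riesz _ (M * nm y)) => [a x z|x].
    by rewrite lT !dotE.
  apply: le_trans (dot_le_abs _ _) _; rewrite mulrAC.
  by rewrite ler_wpM2r ?nrm_ge0.
by exists S => x y; apply: hS.
Qed.

(** The bound comes from |Sx|^2 = <TSx, x> <= M |Sx| |x|. *)
Lemma adjoint_bounded_linear T S :
  bounded_linear T -> adjoint T S -> bounded_linear S.
Proof.
move=> hT hS; split.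
  move=> a x y; apply: dot_ext => z.
  by rewrite !dotE ![<<S _, z>>](psd_sym hdot) -!hS !dotE.
have [M M0 hM] := bounded_linear_gt0 hT; exists M => x.
have : nm (S x) ^+ 2 <= M * nm (S x) * nm x.
  rewrite nrm_sqr -hS; apply: le_trans (dot_le _ _) _.
  by rewrite ler_wpM2r ?nrm_ge0.
have := nrm_ge0 (S x); rewrite le_eqVlt => /orP[/eqP<- _|s0].
  by rewrite mulr_ge0 ?nrm_ge0 // ltW.
by rewrite mulrAC expr2 ler_pM2r.
Qed.

(** * Positive operators, range closures and inverses of coercive operators *)

Definition symmetric_op T : Prop := adjoint T T.

Definition positive T : Prop :=
  [/\ bounded_linear T, symmetric_op T & forall x, 0 <= <<T x, x>>].

Lemma positive_form T : positive T -> psd_form (fun x y => <<T x, y>>).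
Proof.
move=> [[lT _] sT pT]; split=> // [a x y z|x y]; first by rewrite lT !dotE.
by rewrite sT (psd_sym hdot).
Qed.

(** Cauchy-Schwarz for the form of [T], applied to [x] and [T x]. *)
Lemma positive_eq0 T x : positive T -> <<T x, x>> = 0 -> T x = 0.
Proof.
move=> hT h; apply: dot_eq0; apply/eqP; rewrite -sqrf_eq0 eq_le sqr_ge0 andbT.
by have := psd_CS (positive_form hT) x (T x); rewrite h mul0r.
Qed.

Definition range_closure T y : Prop :=
  forall e, 0 < e -> exists x, nm (y - T x) < e.

Lemma range_closure_subspace T : lin T -> subspace (range_closure T).
Proof.
move=> lT; split=> [e e0|a x y hx hy e e0].
  by exists 0; rewrite lin0 // subrr nrm0.
(* The denominator |a| + 1 stays positive when [a = 0]. *)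
have a1 : 0 < `|a| + 1 by rewrite ltr_wpDl.
have [|u hu] := hx (e / 2 / (`|a| + 1)); first by rewrite !divr_gt0.
have [|v hv] := hy (e / 2); first by rewrite divr_gt0.
exists (a *: u + v); rewrite lT.
have -> : a *: x + y - (a *: T u + T v) = a *: (x - T u) + (y - T v).
  by rewrite scalerBr opprD addrACA.
apply: le_lt_trans (nrmD _ _) _; rewrite nrmZ.
move: hu; rewrite ltr_pdivlMr // => hu.
by have := nrm_ge0 (x - T u); nra.
Qed.

Lemma range_closure_closed T : closed_set (range_closure T).
Proof.
move=> y hy e e0; have [|m hm lt_m] := hy (e / 2); first by rewrite divr_gt0.
have [|x hx] := hm (e / 2); first by rewrite divr_gt0.
by exists x; apply: le_lt_trans (nrm_tri m _ _) _; lra.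
Qed.

(** Coercivity bounds [A] from below, which gives injectivity and a closed range; with symmetry it
    also makes the range dense. *)
Lemma coercive_inverse A (c : R) : bounded_linear A -> symmetric_op A ->
  0 < c -> (forall x, c * <<x, x>> <= <<A x, x>>) ->
  exists2 B, bounded_linear B & forall x, B (A x) = x /\ A (B x) = x.
Proof.
move=> hA sA c0 cA; have lA := hA.1.
have lb x : c * nm x <= nm (A x).
  have := le_trans (cA x) (dot_le _ _); rewrite -nrm_sqr.
  have := nrm_ge0 x; rewrite le_eqVlt => /orP[/eqP<- _|x0].
    by rewrite mulr0 nrm_ge0.
  by rewrite expr2 mulrA ler_pM2r.
have injA x : A x = 0 -> x = 0.
  move=> h; apply: nrm_eq0; have := lb x; rewrite h nrm0.
  by rewrite pmulr_rle0.
have onto y : exists x, A x = y.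
  have [p Mp orth] := projection_exists y
    (range_closure_subspace lA) (@range_closure_closed A).
  have My : range_closure A y.
    suff /eqP : y - p = 0 by rewrite subr_eq0 => /eqP ->.
    set w := y - p in orth *; apply: dot_eq0.
    (* The residual [w] is orthogonal to [A w], so coercivity forces it to vanish. *)
    have Mw : range_closure A (A w) by move=> e e0; exists w; rewrite subrr nrm0.
    have := cA w; rewrite sA (orth _ Mw).
    rewrite pmulr_rle0 // => h; apply/eqP.
    by rewrite eq_le (psd_ge0 hdot) andbT.
  (* By the lower bound, preimages of approximations to [y] form a Cauchy sequence with rate
     constant [c^-1]. *)
  have /boolp.choice[u hu] := fun n => My _ (eps_gt0 n).
  have [|l hl] := @complete_eps c^-1 u.
    move=> m n; rewrite -mulrDr ler_pdivlMl //; apply: le_trans (lb _) _.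
    rewrite linB //; apply: le_trans (nrm_tri y _ _) _.
    by apply: lerD; rewrite ?(nrmBC _ y) ltW.
  have [M M0 hM] := bounded_linear_gt0 hA.
  exists l; apply/eqP; rewrite -subr_eq0 -oppr_eq0 opprB; apply/eqP/nrm_eq0.
  apply: (@eps_squeeze _ (1 + M * c^-1)) => n.
  apply: le_trans (nrm_tri (A (u n)) _ _) _; rewrite -linB // mulrDl.
  rewrite mul1r; apply: lerD; first exact: ltW.
  by apply: le_trans (hM _) _; rewrite -mulrA ler_pM2l.
have /boolp.choice[B hB] := onto.
have BA x : B (A x) = x.
  by apply/eqP; rewrite -subr_eq0; apply/eqP/injA; rewrite linB // hB subrr.
exists B => //; split; first by move=> a x y; rewrite -[RHS]BA lA !hB.
by exists c^-1 => x; rewrite ler_pdivlMl // -[in leRHS](hB x).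
Qed.

(** * The square root iteration *)

Definition commutes F G : Prop := forall x, F (G x) = G (F x).

(* Norm-bounded real functions of K: the bicommutant condition is what makes
   the class closed under composition. *)
Definition function_of K F (r : R) : Prop :=
  [/\ 0 <= r, lin F, forall x, nm (F x) <= r * nm x, symmetric_op F &
     forall G, bounded_linear G -> commutes G K -> commutes G F].

Section SquareRootIteration.
Variable K : V -> V.
Hypotheses (bK : bounded_linear K) (sK : symmetric_op K).
Hypothesis cK : forall x, nm (K x) <= nm x.

Lemma function_of_self : function_of K K 1.
Proof. by split=> // [|x]; [case: bK | rewrite mul1r]. Qed.

Lemma function_of_bounded F r : function_of K F r -> bounded_linear F.
Proof. by case=> _ lF bF _ _; split=> //; exists r. Qed.

Lemma function_of_commutes F G r t :
  function_of K F r -> function_of K G t -> commutes F G.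
Proof.
move=> hF [_ _ _ _]; apply; first exact: function_of_bounded hF.
by case: hF => _ _ _ _ cF x; rewrite (cF K).
Qed.

Lemma function_of0 : function_of K (fun=> 0) 0.
Proof.
split=> // [a x y|x|x y|G [lG _] _ x]; first by rewrite scaler0 addr0.
- by rewrite nrm0 mul0r.
- by rewrite !dotE.
- by rewrite lin0.
Qed.

Lemma function_ofD F G r t : function_of K F r -> function_of K G t ->
  function_of K (fun x => F x + G x) (r + t).
Proof.
move=> [r0 lF bF sF cF] [t0 lG bG sG cG]; split.
- exact: addr_ge0.
- by move=> a x y; rewrite lF lG scalerDr addrACA.
- move=> x; have := nrmD (F x) (G x); have := bF x; have := bG x; lra.
- by move=> x y; rewrite !dotE sF sG.
- by move=> H bH cH x; rewrite (linD bH.1) cF // cG.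
Qed.

Lemma function_ofZ a F r : 0 <= a -> function_of K F r ->
  function_of K (fun x => a *: F x) (a * r).
Proof.
move=> a0 [r0 lF bF sF cF]; split.
- exact: mulr_ge0.
- by move=> c x y; rewrite lF scalerDr !scalerA mulrC.
- by move=> x; rewrite nrmZ ger0_norm // -mulrA ler_wpM2l.
- by move=> x y; rewrite !dotE sF.
- by move=> H bH cH x; rewrite (linZ bH.1) cF.
Qed.

Lemma function_of_comp F G r t : function_of K F r -> function_of K G t ->
  function_of K (fun x => F (G x)) (r * t).
Proof.
move=> hF hG; have cFG := function_of_commutes hF hG.
case: hF hG => [r0 lF bF sF cF] [t0 lG bG sG cG]; split.
- exact: mulr_ge0.
- by move=> a x y; rewrite lG lF.
- by move=> x; apply: le_trans (bF _) _; rewrite -mulrA ler_wpM2l.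
- by move=> x y; rewrite sF sG cFG.
- by move=> H bH cH x; rewrite (cF _ bH cH) (cG _ bH cH).
Qed.

(** The recursion Y_{n+1} = (K + Y_n^2) / 2 from 0, whose limit plays the role of 1 - (1 -
    K)^{1/2}. *)
Fixpoint sqrt_iter n : V -> V :=
  if n is m.+1 then fun x => 2^-1 *: (K x + sqrt_iter m (sqrt_iter m x))
  else fun=> 0.

Lemma sqrt_iterS n x :
  sqrt_iter n.+1 x = 2^-1 *: (K x + sqrt_iter n (sqrt_iter n x)).
Proof. by []. Qed.

(** The same recursion for the scalar 1 in place of [K]; it majorizes the norms of the iterates, and
    its increments those of their differences. *)
Fixpoint sqrt_iter_norm n : R :=
  if n is m.+1 then 2^-1 * (1 + sqrt_iter_norm m * sqrt_iter_norm m) else 0.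

(** The gap d = 1 - y satisfies d' = d - d^2 / 2, which is increasing in d on [0, 1] and so
    preserves a bound 2 / (n + 2). *)
Lemma sqrt_iter_norm_bound n :
  0 <= sqrt_iter_norm n <= 1 /\ 1 - sqrt_iter_norm n <= 2 * eps n.+1.
Proof.
elim: n => [|n [/andP[y0 y1] h]] /=.
  rewrite lexx ler01 subr0 /eps; split=> //; have -> : (2:R) * 2^-1 = 1 by field.
  exact: lexx.
have e0 := eps_gt0 n.+1; have e0' := eps_gt0 n.+2.
have ee : eps n.+2 * (1 + eps n.+1) = eps n.+1.
  have a0 : 0 < n.+2%:R :> R by rewrite ltr0n.
  rewrite /eps -[n.+3%:R]natr1; move: (n.+2%:R) a0 => a a0.
  by field; apply/andP; split; apply/eqP; lra.
have e1 : eps n.+1 <= 2^-1 by apply: (@eps_le 1).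
move: (sqrt_iter_norm n) (eps n.+1) (eps n.+2) y0 y1 h e0 e0' ee e1.
move=> y e e' y0 y1 h e0 e0' ee e1.
split; first by apply/andP; split; nra.
(* Monotonicity of d - d^2 / 2 between d = 1 - y and 2e; the next two facts give e - e^2 <= e'. *)
have : 0 <= (2 * e - (1 - y)) * (1 - (2 * e + (1 - y)) / 2) by apply: mulr_ge0; lra.
have : e' * (1 + e) * (1 - e) = e * (1 - e) by rewrite ee.
have : 0 <= e' * e ^+ 2 by rewrite mulr_ge0 ?sqr_ge0 // ltW.
lra.
Qed.

Lemma function_of_sqrt_iter n : function_of K (sqrt_iter n) (sqrt_iter_norm n).
Proof.
elim: n => [|n IH] /=; first exact: function_of0.
apply: function_ofZ; first by rewrite invr_ge0.
apply: function_ofD function_of_self _.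
exact: (function_of_comp IH IH).
Qed.

(* Y_{n+2} - Y_{n+1} = (Y_{n+1} - Y_n) (Y_{n+1} + Y_n) / 2 *)
Lemma function_of_sqrt_iter_step n :
  function_of K (fun x => sqrt_iter n.+1 x - sqrt_iter n x)
    (sqrt_iter_norm n.+1 - sqrt_iter_norm n).
Proof.
elim: n => [|n IH].
  have -> : (fun x => sqrt_iter 1 x - sqrt_iter 0 x) = (fun x => 2^-1 *: K x).
    by apply/funext => x /=; rewrite addr0 subr0.
  have -> : sqrt_iter_norm 1 - sqrt_iter_norm 0 = 2^-1 * 1 by rewrite /=; ring.
  by apply: function_ofZ function_of_self; rewrite invr_ge0.
have hn := function_of_sqrt_iter n; have hn1 := function_of_sqrt_iter n.+1.
have := function_ofZ (a := 2^-1) _ (function_of_comp IH (function_ofD hn1 hn)).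
have -> : sqrt_iter_norm n.+2 - sqrt_iter_norm n.+1 =
   2^-1 * ((sqrt_iter_norm n.+1 - sqrt_iter_norm n) *
           (sqrt_iter_norm n.+1 + sqrt_iter_norm n)) by rewrite /=; ring.
have -> : (fun x => sqrt_iter n.+2 x - sqrt_iter n.+1 x) =
   (fun x => 2^-1 *: (sqrt_iter n.+1 (sqrt_iter n.+1 x + sqrt_iter n x)
                    - sqrt_iter n (sqrt_iter n.+1 x + sqrt_iter n x))).
  apply/funext => x.
  rewrite (sqrt_iterS n.+1) [X in _ - X = _]sqrt_iterS.
  case: (hn) (hn1) => _ ln _ _ _ [_ ln1 _ _ _].
  rewrite (linD ln) (linD ln1) (function_of_commutes hn hn1) -scalerBr.
  congr (_ *: _); apply: dot_ext => z; rewrite !dotE; ring.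
by apply; rewrite invr_ge0.
Qed.

(** The step bounds telescope to a scalar increment, which is at most [1 - sqrt_iter_norm n]. *)
Lemma sqrt_iter_cauchy n k x :
  nm (sqrt_iter (n + k) x - sqrt_iter n x) <= 2 * eps n * nm x.
Proof.
apply: (@le_trans _ _ ((sqrt_iter_norm (n + k) - sqrt_iter_norm n) * nm x)).
  elim: k => [|k IH]; first by rewrite addn0 !subrr nrm0 mul0r.
  rewrite addnS; apply: le_trans (nrm_tri (sqrt_iter (n + k) x) _ _) _.
  by case: (function_of_sqrt_iter_step (n + k)) => _ _ /(_ x) h _ _; lra.
rewrite ler_wpM2r ?nrm_ge0 //.
have [_] := sqrt_iter_norm_bound n.
have [/andP[_ h1] _] := sqrt_iter_norm_bound (n + k).
by have := eps_le (leqnSn n); lra.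
Qed.

(** The fixed point equation says (1 - Y)^2 = 1 - K. Each property of the iterates passes to the
    pointwise limit through a bound of order [eps n]. *)
Lemma one_sub_sqrt_exists : exists2 Y, function_of K Y 1 &
  forall x, Y x = 2^-1 *: (K x + Y (Y x)).
Proof.
have /boolp.choice[Y hY] : forall x, exists l, forall n,
    nm (sqrt_iter n x - l) <= 2 * nm x * eps n.
  move=> x; apply: complete_eps => m n.
  wlog mn : m n / (m <= n)%N.
    by move=> h; case/orP: (leq_total m n) => /h; last rewrite nrmBC [leRHS]addrC.
  have := sqrt_iter_cauchy m (n - m) x; rewrite subnKC // nrmBC.
  have : 0 <= 2 * nm x * eps n by rewrite !mulr_ge0 ?nrm_ge0 // ltW ?eps_gt0.
  lra.
have Yeq x y c : (forall n, nm (x - y) <= c * eps n) -> x = y.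
  by move=> h; apply/eqP; rewrite -subr_eq0; apply/eqP/nrm_eq0/(eps_squeeze h).
have fY := function_of_sqrt_iter.
have lY : lin Y.
  move=> a x y.
  apply: (Yeq _ _ (2 * nm (a *: x + y) + `|a| * (2 * nm x) + 2 * nm y)) => n.
  have [_ ln _ _ _] := fY n.
  have -> : Y (a *: x + y) - (a *: Y x + Y y) =
    - (sqrt_iter n (a *: x + y) - Y (a *: x + y))
    + (a *: (sqrt_iter n x - Y x) + (sqrt_iter n y - Y y)).
    by rewrite ln; apply: dot_ext => z; rewrite !dotE; ring.
  apply: le_trans (nrmD _ _) _; rewrite nrmN.
  have := nrmD (a *: (sqrt_iter n x - Y x)) (sqrt_iter n y - Y y).
  rewrite nrmZ; have := hY (a *: x + y) n; have := hY y n.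
  have := ler_wpM2l (normr_ge0 a) (hY x n); lra.
have bY x : nm (Y x) <= nm x.
  rewrite -subr_le0; apply: (@eps_squeeze _ (2 * nm x)) => n.
  have [_ _ bn _ _] := fY n; have [/andP[_ h1] _] := sqrt_iter_norm_bound n.
  have := bn x; have := hY x n.
  have := nrmD (sqrt_iter n x) (- (sqrt_iter n x - Y x)).
  rewrite opprB addrC subrK [nm (Y x - _)]nrmBC.
  have := ler_wpM2r (nrm_ge0 x) h1; lra.
exists Y; last first.
  move=> x; apply: (Yeq _ _ (3 * nm x + nm (Y x))) => n.
  have [_ ln bn _ _] := fY n; have [/andP[_ h1] _] := sqrt_iter_norm_bound n.
  have -> : Y x - 2^-1 *: (K x + Y (Y x)) =
     - (sqrt_iter n.+1 x - Y x)
     + 2^-1 *: (sqrt_iter n (sqrt_iter n x - Y x) + (sqrt_iter n (Y x) - Y (Y x))).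
    by rewrite /= (linB ln); apply: dot_ext => z; rewrite !dotE; ring.
  apply: le_trans (nrmD _ _) _; rewrite nrmN nrmZ ger0_norm ?invr_ge0 //.
  have := nrmD (sqrt_iter n (sqrt_iter n x - Y x)) (sqrt_iter n (Y x) - Y (Y x)).
  have := hY x n.+1; have := hY (Y x) n; have := hY x n.
  have := bn (sqrt_iter n x - Y x).
  have := ler_wpM2r (nrm_ge0 (sqrt_iter n x - Y x)) h1.
  have : nm x * eps n.+1 <= nm x * eps n by rewrite ler_wpM2l ?nrm_ge0 ?eps_le.
  lra.
split=> //; first by move=> x; rewrite mul1r.
- move=> x y; apply/eqP; rewrite -subr_eq0 -normr_le0.
  apply: (@eps_squeeze _ (4 * nm x * nm y)) => n; have [_ _ _ sn _] := fY n.
  have -> : <<Y x, y>> - <<x, Y y>> =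
     <<x, sqrt_iter n y - Y y>> - <<sqrt_iter n x - Y x, y>>.
    by rewrite !dotE sn; ring.
  apply: le_trans (ler_normB _ _) _.
  have := dot_le_abs x (sqrt_iter n y - Y y).
  have := dot_le_abs (sqrt_iter n x - Y x) y.
  have := ler_wpM2l (nrm_ge0 x) (hY y n); have := ler_wpM2r (nrm_ge0 y) (hY x n).
  lra.
- move=> G bG cG x; have [M M0 hM] := bounded_linear_gt0 bG.
  apply: (Yeq _ _ (2 * M * nm x + 2 * nm (G x))) => n; have [_ _ _ _ cn] := fY n.
  have -> : G (Y x) - Y (G x) =
     (sqrt_iter n (G x) - Y (G x)) - G (sqrt_iter n x - Y x).
    rewrite (linB bG.1) cn //; apply: dot_ext => z; rewrite !dotE; ring.
  apply: le_trans (nrmD _ _) _; rewrite nrmN.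
  have := hM (sqrt_iter n x - Y x); have := ler_wpM2l (ltW M0) (hY x n).
  have := hY (G x) n; lra.
Qed.

End SquareRootIteration.

(** * Operator inequalities from Cauchy-Schwarz *)

Lemma positive_contraction K : positive K ->
  (forall x, <<K x, x>> <= <<x, x>>) -> forall x, nm (K x) <= nm x.
Proof.
move=> hK h x; rewrite nrm_le_sqr.
(* This yields |Kx|^4 <= <Kx, x> <KKx, Kx> <= |x|^2 |Kx|^2. *)
have := psd_CS (positive_form hK) x (K x); have := h x; have := h (K x).
have [_ _ pK] := hK; have := pK x; have := pK (K x).
have := psd_ge0 hdot (K x); have := psd_ge0 hdot x.
rewrite le_eqVlt => /orP[/eqP<-|x0]; rewrite le_eqVlt => /orP[/eqP<-|k0].
all: by rewrite ?(ltW x0) // => *; nra.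
Qed.

(** That is, K^2 <= K. It serves to show that the dual of a contraction is expansive. *)
Lemma positive_le1_sqr K : positive K -> (forall x, <<K x, x>> <= <<x, x>>) ->
  forall x, <<K x, K x>> <= <<K x, x>>.
Proof.
move=> hK h x; have := psd_CS (positive_form hK) x (K x).
have := h (K x); have [_ _ pK] := hK; have := pK x.
have := psd_ge0 hdot (K x); rewrite le_eqVlt => /orP[/eqP<-//|k0] *; nra.
Qed.

(** That is, A <= A^2 if A >= 1, from <Ax, x>^2 <= |Ax|^2 |x|^2. It serves to show that the dual of
    an expansive operator is a contraction. *)
Lemma ge1_sqr A : (forall x, <<x, x>> <= <<A x, x>>) ->
  forall x, <<A x, x>> <= <<A x, A x>>.
Proof.
move=> h x; have := psd_CS hdot (A x) x; have := h x; have := psd_ge0 hdot (A x).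
have := psd_ge0 hdot x; rewrite le_eqVlt => /orP[/eqP x0|x0] *; last nra.
by rewrite (dot_eq0 (esym x0)) !dotE psd_ge0.
Qed.

(** * Positive square roots: existence, bicommutant property, uniqueness *)

Lemma positive_sqrt_exists A : positive A -> exists2 S,
  positive S /\ (forall x, S (S x) = A x) &
  forall G, bounded_linear G -> commutes G A -> commutes G S.
Proof.
move=> hA; have [bA sA pA] := hA; have [M M0 hM] := bounded_linear_gt0 bA.
have lA := bA.1.
(* Scaling by a norm bound puts K = 1 - A / M between 0 and 1; the root of [A] is then M^{1/2} (1 -
   Y). *)
pose K x := x - M^-1 *: A x.
have bK : bounded_linear K.
  apply: bounded_linearB bounded_linear_id _.
  exact: bounded_linear_comp (bounded_linearZ _) bA.
have sK : symmetric_op K by move=> x y; rewrite !dotE sA.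
have pK : positive K.
  split=> // x; rewrite !dotE subr_ge0 ler_pdivrMl //.
  apply: le_trans (dot_le _ _) _; rewrite -nrm_sqr expr2 mulrA.
  by rewrite ler_wpM2r ?nrm_ge0.
have cK : forall x, nm (K x) <= nm x.
  apply: positive_contraction => // x; rewrite !dotE gerBl mulr_ge0 // invr_ge0.
  exact: ltW.
have [Y [_ lY bY sY cY] eqY] := one_sub_sqrt_exists bK sK cK.
have bdY : bounded_linear Y by split=> //; exists 1.
exists (fun x => Num.sqrt M *: (x - Y x)); last first.
  move=> G bG cG x; have lG := bG.1; rewrite (linZ lG) (linB lG) cY // => z.
  by rewrite /K (linB lG) (linZ lG) cG.
split; first split.
- apply: (bounded_linear_comp (T := *:%R (Num.sqrt M)) (bounded_linearZ _)).
  exact: bounded_linearB bounded_linear_id bdY.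
- by move=> x y; rewrite !dotE sY.
- move=> x; rewrite !dotE mulr_ge0 ?sqrtr_ge0 // subr_ge0.
  apply: le_trans (dot_le _ _) _; rewrite -nrm_sqr expr2 ler_wpM2r ?nrm_ge0 //.
  by have := bY x; rewrite mul1r.
move=> x; rewrite (linZ lY) (linB lY) -scalerBr scalerA -expr2 sqr_sqrtr ?(ltW M0) //.
have hx := eqY x; have -> : A x = M *: (x - K x).
  by rewrite /K opprB addrC subrK scalerA divff ?gt_eqF // scale1r.
congr (_ *: _).
have -> : K x = 2 *: Y x - Y (Y x).
  rewrite {1}hx; apply: dot_ext => z; rewrite !dotE.
  by field; rewrite gt_eqF.
by apply: dot_ext => z; rewrite !dotE; ring.
Qed.

(** For y = (S - B)x one has (S + B)y = S^2 x - B^2 x = 0, so positivity gives Sy = By = 0, and then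
    <y, y> = <(S - B)y, x> = 0. *)
Lemma commuting_sqrt_unique S B : positive S -> positive B ->
  (forall x, S (S x) = B (B x)) -> commutes B S -> S =1 B.
Proof.
move=> hS hB SB cBS x; have [[lS _] sS pS] := hS; have [[lB _] sB pB] := hB.
set y := S x - B x.
have h : <<S y, y>> + <<B y, y>> = 0.
  have -> : S y = - B y.
    by rewrite /y (linB lS) (linB lB) SB cBS opprB.
  by rewrite dotE addNr.
have /(positive_eq0 hS) Sy : <<S y, y>> = 0 by have := pS y; have := pB y; lra.
have /(positive_eq0 hB) By : <<B y, y>> = 0 by have := pS y; have := pB y; lra.
apply/eqP; rewrite -subr_eq0; apply/eqP/dot_eq0; rewrite -/y {2}/y.
by rewrite (psdDr hdot) (psdNr hdot) -sS -sB Sy By !dotE subr0.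
Qed.

(** If S is the square root of B, then A commutes with S and <ABx, x> = <ASx, Sx>. *)
Lemma positive_comp A B : positive A -> positive B -> commutes A B ->
  positive (fun x => A (B x)).
Proof.
move=> hA hB cAB; have [S [[bS sS pS] SS] cS] := positive_sqrt_exists hB.
have [bA sA pA] := hA; have [bB sB pB] := hB.
split; first exact: bounded_linear_comp bA bB.
  by move=> x y; rewrite sA sB cAB.
by move=> x; rewrite -SS (cS A) // sS; apply: pA.
Qed.

(** [S] commutes with its square, hence with the root constructed from that square, and therefore
    equals it. *)
Lemma positive_sqrt_bicommutant S G : positive S -> bounded_linear G ->
  commutes G (fun x => S (S x)) -> commutes G S.
Proof.
move=> hS bG cG.
have [S0 [hS0 eS0] cS0] := positive_sqrt_exists (positive_comp hS hS (fun=> erefl)).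
have e0 : S0 =1 S.
  by apply: commuting_sqrt_unique => //; apply: cS0 => //; case: hS.
by move=> x; rewrite -!e0; apply: cS0.
Qed.

Lemma positive_sqrt_unique S B : positive S -> positive B ->
  (forall x, S (S x) = B (B x)) -> S =1 B.
Proof.
move=> hS hB e; apply: commuting_sqrt_unique => //.
apply: positive_sqrt_bicommutant => // [|x]; first by case: hB.
by rewrite !e.
Qed.

(** * Transfer of regularity and norm bounds across Cauchy duality *)

Lemma inverse_commutes A B G : (forall x, A (B x) = x) ->
  (forall x, B (A x) = x) -> commutes G A -> commutes G B.
Proof. by move=> AB BA h x; rewrite -{2}[x]AB h BA. Qed.

(* In operator terms: C is the Cauchy dual of T, A = T^*T, B = C^*C,
   Q = Delta_T^{1/2} and D = D_C. *)
Section CauchyDualPair.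
Variables T C A B Q D : V -> V.
Hypotheses (bT : bounded_linear T) (bC : bounded_linear C).
Hypotheses (bA : bounded_linear A) (pB : positive B).
Hypotheses (AB : forall x, A (B x) = x) (BA : forall x, B (A x) = x).
Hypotheses (TC : forall x, T x = C (A x)) (CT : forall x, C x = T (B x)).
Hypotheses (pQ : positive Q) (QQ : forall x, Q (Q x) = A x - x).
Hypotheses (pD : positive D) (DD : forall x, D (D x) = x - B x).

Let AQ x : A x = Q (Q x) + x. Proof. by rewrite QQ subrK. Qed.

Let BD x : B x = x - D (D x). Proof. by rewrite DD opprB addrC subrK. Qed.

(** Take E = B^{1/2}. It commutes with Q, so QE is positive with square (A - 1)B = 1 - B = D^2, and
    uniqueness of roots gives D = QE. *)
Lemma defect_factorization : exists E,
  [/\ bounded_linear E, forall x, E (E x) = B x,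
     forall G, bounded_linear G -> commutes G B -> commutes G E,
     commutes E Q /\ commutes E A & forall x, D x = Q (E x)].
Proof.
have [E [pE EE] cE] := positive_sqrt_exists pB.
have [bQ _ _] := pQ; have [bE _ _] := pE.
have cQA : commutes Q A by move=> x; rewrite !AQ (linD bQ.1).
have cQE := cE Q bQ (inverse_commutes AB BA cQA).
have cAE : commutes A E by apply: cE => // x; rewrite AB BA.
exists E; split=> //; first by split=> x.
apply: positive_sqrt_unique => // [|x].
  exact: positive_comp.
by rewrite -cQE QQ EE DD AB.
Qed.

(** An operator commuting with Q commutes with A = Q^2 + 1, hence with B and E. So the factors of DC
    = E(QT)B and D = QE commute pairwise. *)
Lemma regular_defect : commutes (Q \o T) Q -> commutes (D \o C) D.
Proof.
have [E [bE EE cE [cEQ cEA] DQ]] := defect_factorization.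
have [bQ _ _] := pQ; have [bB _ _] := pB.
set S := Q \o T => cSQ; have bS : bounded_linear S by apply: bounded_linear_comp.
have cSB : commutes S B.
  apply: (inverse_commutes AB BA) => x.
  by rewrite !AQ (linD bS.1) !cSQ.
have cSE := cE S bS cSB.
have cEB x : E (B x) = B (E x) by rewrite -!EE.
have cQB : commutes Q B.
  by apply: (inverse_commutes AB BA) => x; rewrite !AQ (linD bQ.1).
have DC x : D (C x) = E (S (B x)) by rewrite DQ CT cEQ.
move=> x; rewrite /= !DC !DQ.
by rewrite -cQB cSQ cEQ -cEB cSE.
Qed.

Lemma regular_defect_norm : commutes (Q \o T) Q ->
  (forall x, nm (Q (T x)) <= nm (Q x)) -> forall x, nm (D (C x)) <= nm (B (D x)).
Proof.
have [E [bE EE cE [cEQ cEA] DQ]] := defect_factorization.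
have [bQ _ _] := pQ; have [bB _ _] := pB.
set S := Q \o T => cSQ le_S x.
have bS : bounded_linear S by apply: bounded_linear_comp.
have cSB : commutes S B.
  by apply: (inverse_commutes AB BA) => y; rewrite !AQ (linD bS.1) !cSQ.
have cQB : commutes Q B.
  by apply: (inverse_commutes AB BA) => y; rewrite !AQ (linD bQ.1).
(* Both sides become those of [le_S] at the vector [E (B x)]. *)
have -> : D (C x) = S (E (B x)) by rewrite (cE S) // DQ CT cEQ.
have -> : B (D x) = Q (E (B x)) by rewrite DQ -cQB -!EE.
exact: le_S.
Qed.

(** The inverse of E is AE, so Q = DAE and QT = AE(DC)A. Commuting with D passes to B = 1 - D^2,
    hence to A and E. *)
Lemma defect_regular_Delta : commutes (D \o C) D -> commutes (Q \o T) Q.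
Proof.
have [E [bE EE cE [cEQ cEA] DQ]] := defect_factorization.
have [bD _ _] := pD; have [bB _ _] := pB.
set S := D \o C => cSD; have bS : bounded_linear S by apply: bounded_linear_comp.
have cSB : commutes S B by move=> x; rewrite !BD (linB bS.1) !cSD.
have cDB : commutes D B by move=> x; rewrite !BD (linB bD.1).
have cSA := inverse_commutes BA AB cSB; have cDA := inverse_commutes BA AB cDB.
have cSE := cE S bS cSB; have cDE := cE D bD cDB.
have QD x : Q x = D (A (E x)) by rewrite DQ cEA EE AB.
have QT x : Q (T x) = A (E (S (A x))) by rewrite QD TC cDA cDE.
move=> x; rewrite /= !QT !QD.
by rewrite -cDA cSD -cDE -cDA !cSA !cSE !cEA.
Qed.

Lemma defect_regular_Delta_norm : commutes (D \o C) D ->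
  (forall x, nm (D (C x)) <= nm (B (D x))) -> forall x, nm (Q (T x)) <= nm (Q x).
Proof.
have [E [bE EE cE [cEQ cEA] DQ]] := defect_factorization.
have [bD _ _] := pD; have [bB _ _] := pB.
set S := D \o C => cSD le_S x.
have bS : bounded_linear S by apply: bounded_linear_comp.
have cSB : commutes S B by move=> y; rewrite !BD (linB bS.1) !cSD.
have cDB : commutes D B by move=> y; rewrite !BD (linB bD.1).
have cSA := inverse_commutes BA AB cSB; have cDA := inverse_commutes BA AB cDB.
have cSE := cE S bS cSB; have cDE := cE D bD cDB.
have QD y : Q y = D (A (E y)) by rewrite DQ cEA EE AB.
(* Both sides become those of [le_S] at the vector [A (E (A x))]. *)
have -> : Q (T x) = S (A (E (A x))).
  by rewrite cSA cSE QD TC cDA cDE.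
have -> : Q x = B (D (A (E (A x)))) by rewrite -cDB BA cEA QD.
exact: le_S.
Qed.

End CauchyDualPair.

(** * Projection onto the closure of the range of the defect operator *)

Lemma range_closure_orth D v : (forall z, <<v, D z>> = 0) ->
  forall y, range_closure D y -> <<v, y>> = 0.
Proof.
move=> h y hy; apply/eqP; rewrite -normr_le0.
apply: (@eps_squeeze _ (nm v)) => n; have [x hx] := hy _ (eps_gt0 n).
have -> : <<v, y>> = <<v, y - D x>> by rewrite (psdDr hdot) (psdNr hdot) h subr0.
by apply: le_trans (dot_le_abs _ _) _; rewrite ler_wpM2l ?nrm_ge0 // ltW.
Qed.

Lemma range_closure_range D k : range_closure D (D k).
Proof. by move=> e e0; exists k; rewrite subrr nrm0. Qed.

Lemma range_closureB D x y : lin D -> range_closure D x -> range_closure D y ->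
  range_closure D (x - y).
Proof.
by move=> /range_closure_subspace[_ h] hx hy; rewrite addrC -scaleN1r; apply: h.
Qed.

Section RangeProjection.
Variables D C B P : V -> V.
Hypotheses (pD : positive D) (bC : bounded_linear C) (bB : bounded_linear B).
Hypothesis cCD : commutes (D \o C) D.
Hypothesis hP : forall x, range_closure D (P x) /\
  forall y, range_closure D y -> <<x - P x, y>> = 0.

(** Regularity says that D annihilates CDk - DCk; this difference is thus orthogonal to the range of
    D, while DCk lies in it. *)
Lemma projection_defect k : P (C (D k)) = D (C k).
Proof.
have [[lD _] sD _] := pD; have [M0 h0] := hP (C (D k)).
have hw := range_closureB lD M0 (range_closure_range D (C k)).
have v0 z : <<C (D k) - D (C k), D z>> = 0.
  by rewrite -sD (linB lD) [D (C (D k))]cCD /= subrr dotE.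
apply/eqP; rewrite -subr_eq0; apply/eqP/dot_eq0.
set w := P _ - _ in hw *; rewrite {1}/w.
have := h0 _ hw; have := range_closure_orth v0 hw; clearbody w; rewrite !dotE; lra.
Qed.

(** On the range of [D] the claim is the hypothesis, by [projection_defect]; continuity extends it
    to the closure. *)
Lemma projection_defect_norm : (forall k, nm (D (C k)) <= nm (B (D k))) ->
  forall h, range_closure D h -> nm (P (C h)) <= nm (B h).
Proof.
move=> le_k h hh; rewrite -subr_le0.
have [[lD _] _ _] := pD.
have [M M0 hM] := bounded_linear_gt0 bC; have [N N0 hN] := bounded_linear_gt0 bB.
apply: (@eps_squeeze _ (M + N)) => n; have [k hk] := hh _ (eps_gt0 n).
(* Orthogonality of the residuals makes [P] nonexpansive. *)
have le_w : nm (P (C h) - P (C (D k))) <= M * eps n.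
  apply: (@le_trans _ _ (nm (C (h - D k)))); last first.
    by apply: le_trans (hM _) _; rewrite ler_wpM2l // ltW.
  have [M1 h1] := hP (C h); have [M2 h2] := hP (C (D k)).
  have hw := range_closureB lD M1 M2.
  set w := P (C h) - P (C (D k)) in hw *.
  have : nm w ^+ 2 <= nm (C (h - D k)) * nm w.
    apply: le_trans (dot_le _ _); rewrite (linB bC.1) nrm_sqr {1}/w.
    have := h1 _ hw; have := h2 _ hw; clearbody w; rewrite !dotE; lra.
  have := nrm_ge0 w; rewrite le_eqVlt => /orP[/eqP<- _|w0]; first exact: nrm_ge0.
  by rewrite expr2 ler_pM2r.
have := nrmD (P (C h) - P (C (D k))) (P (C (D k))); rewrite subrK.
rewrite {2}projection_defect.
have := le_k k; have := nrmD (B h) (- B (h - D k)).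
rewrite nrmN (linB bB.1) opprB addrC subrK -(linB bB.1).
have := hN (h - D k); have : N * nm (h - D k) <= N * eps n by rewrite ler_wpM2l // ltW.
lra.
Qed.

End RangeProjection.

(** The sequence |T^n x|^2 is concave in n; if its first step were negative, it would eventually
    become negative. *)
Lemma concave_expansive T : 
  (forall x, <<T (T x), T (T x)>> - 2 * <<T x, T x>> + <<x, x>> <= 0) ->
  forall x, <<x, x>> <= <<T x, T x>>.
Proof.
move=> hT x; pose a n := <<iter n T x, iter n T x>>.
have a0 n : 0 <= a n by apply: psd_ge0.
have step n : a n.+1 - a n <= a 1%N - a 0%N.
  elim: n => // n IH; have := hT (iter n T x); rewrite -/(a n.+2) -/(a n.+1) -/(a n).
  lra.
have bnd n : a n <= a 0%N + n%:R * (a 1%N - a 0%N).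
  elim: n => [|n IH]; first by rewrite mul0r addr0.
  have := step n; rewrite -natr1 mulrDl mul1r; lra.
rewrite -/(a 0%N) -/(a 1%N) leNgt; apply/negP => lt10.
have d0 : 0 < a 0%N - a 1%N by lra.
have := archi_boundP (divr_ge0 (a0 0%N) (ltW d0)).
rewrite ltr_pdivrMr //; move: (Num.bound _) => n.
have := bnd n; have := a0 n; lra.
Qed.

End RealHilbert.

(** * Restriction of scalars to the reals *)

(** A separate name for [V], so that the real module structure does not compete with the complex
    one. *)
Definition realified (R : realType) (V : lmodType R[i]) : Type := V.

Section Realified.
Variables (R : realType) (V : lmodType R[i]).

HB.instance Definition _ := GRing.Zmodule.copy (realified V) V.

Definition rscale (a : R) (x : realified V) : realified V :=
  ((a%:C)%C *: (x : V)).

Fact rscaleA a b v : rscale a (rscale b v) = rscale (a * b) v.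
Proof. by rewrite /rscale rmorphM scalerA. Qed.

Fact rscale1 : left_id 1 rscale.
Proof. by move=> v; rewrite /rscale rmorph1 scale1r. Qed.

Fact rscaleDr : right_distributive rscale +%R.
Proof. by move=> a u v; exact: scalerDr. Qed.

Fact rscaleDl v : {morph rscale^~ v : a b / a + b}.
Proof. by move=> a b; rewrite /rscale rmorphD; exact: scalerDl. Qed.

HB.instance Definition _ := GRing.Zmodule_isLmodule.Build R (realified V)
  rscaleA rscale1 rscaleDr rscaleDl.

End Realified.

(** * From the real to the complex Hilbert space *)

Section ComplexHilbert.
Variables (R : realType) (V : lmodType R[i]) (ip : V -> V -> R[i]).
Hypothesis HH : hilbert ip.
Implicit Types (x y z : V) (T S A B C D : V -> V).

Definition rdot (x y : realified V) : R := complex.Re (ip x y).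

Local Notation "<< x , y >>" := (rdot x y) (format "<< x ,  y >>").
Local Notation nm := (nrm rdot).
Local Notation blin := (@bounded_linear R (realified V) rdot).
Local Notation pos := (@positive R (realified V) rdot).

Lemma ipP a x y z : ip (a *: x + y) z = a * ip x z + ip y z.
Proof. by case: HH => -[]. Qed.

Lemma ip_conj x y : ip y x = (ip x y)^*.
Proof. by case: HH => -[]. Qed.

Lemma ip_ge0 x : 0 <= ip x x.
Proof. by case: HH => -[]. Qed.

Lemma ipD x y z : ip (x + y) z = ip x z + ip y z.
Proof. by rewrite -[x]scale1r ipP mul1r scale1r. Qed.

Lemma ip0 z : ip 0 z = 0.
Proof. by apply: (@addrI _ (ip 0 z)); rewrite -ipD !addr0. Qed.

Lemma ipZ a x z : ip (a *: x) z = a * ip x z.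
Proof. by rewrite -[a *: x]addr0 ipP ip0 addr0. Qed.

Lemma conjE (z : R[i]) : z^* = (z^*)%C.
Proof. by []. Qed.

Lemma ip_self x : ip x x = (<<x, x>>%:C)%C.
Proof.
have := ip_ge0 x; rewrite /rdot; case: (ip x x) => a b.
by rewrite lecE /= => /andP[/eqP-> _].
Qed.

Lemma hnormE x : hnorm ip x = ((nm x)%:C)%C.
Proof.
rewrite /hnorm ip_self -[<<x, x>>]sqr_sqrtr; last first.
  by have := ip_ge0 x; rewrite ip_self ler0c.
by rewrite rmorphXn /= sqrCK // ler0c sqrtr_ge0.
Qed.

Lemma rdot_hilbert : real_hilbert (V := realified V) rdot.
Proof.
split; first split.
- move=> a x y z; rewrite /rdot [ip (a *: x + y) z]ipP /=.
  by case: (ip x z) (ip y z) => [b c] [d e] /=; rewrite mul0r subr0.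
- by move=> x y; rewrite /rdot ip_conj conjE; case: (ip x y).
- by move=> x; have := ip_ge0 x; rewrite ip_self ler0c.
- move=> x h; case: HH => -[_ _ _ d] _; apply: d.
  by rewrite ip_self h.
move=> u hu; case: HH => _ /(_ u)[].
  (* A positive complex number is real. *)
  move=> e e0; have er : e = ((complex.Re e)%:C)%C.
    by move: e0; case: (e) => a b; rewrite ltcE /= => /andP[/eqP-> _].
  have [|N hN] := hu (complex.Re e); first by rewrite -ltcR -er.
  by exists N => m n hm hn; rewrite hnormE er ltcR; apply: hN.
move=> l hl; exists l => e e0; have [|N hN] := hl (e%:C)%C; first by rewrite ltcR.
by exists N => n hn; have := hN n hn; rewrite hnormE ltcR.
Qed.

Let rH := rdot_hilbert.
Let rP : psd_form (V := realified V) rdot. Proof. by case: rH. Qed.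

Definition clin T : Prop := forall (a : R[i]) x y, T (a *: x + y) = a *: T x + T y.

Lemma bopP T : bop ip T <-> clin T /\ blin T.
Proof.
split=> [[lT [M hM]]|[lT [_ [M hM]]]].
  split=> //; split; first by move=> a x y; apply: lT.
  exists (complex.Re M) => x; have := hM x; rewrite !hnormE lecE => /andP[_ /=].
  by case: (M) => p q /=; rewrite mulr0 subr0.
by split=> //; exists (M%:C)%C => x; rewrite !hnormE -rmorphM lecR.
Qed.

Lemma bop_clin T : bop ip T -> clin T. Proof. by case/bopP. Qed.

Lemma bop_blin T : bop ip T -> blin T. Proof. by case/bopP. Qed.

Lemma clinZ T a x : clin T -> T (a *: x) = a *: T x.
Proof.
move=> lT; have T0 : T 0 = 0.
  by have := lT (-1) 0 0; rewrite scaler0 addr0 scaleN1r addNr.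
by rewrite -[a *: x]addr0 lT T0 addr0.
Qed.

Lemma rdot_ext x y : (forall z, <<x, z>> = <<y, z>>) -> x = y.
Proof. exact: (dot_ext rH). Qed.

Lemma rdotiE x y : <<('i%C : R[i]) *: x, y>> = - complex.Im (ip x y).
Proof. by rewrite /rdot ipZ; case: (ip x y) => a b /=; rewrite mul0r mul1r sub0r. Qed.

(* A complex-linear operator is determined by the real part of its sesquilinear
   form, because Im z = - Re (i z). *)
Lemma is_adjointP T S : clin T ->
  is_adjoint ip T S <-> adjoint (V := realified V) rdot T S.
Proof.
move=> lT; split=> [h x y|h x y]; first by rewrite /rdot h.
have e1 := h x y; have := h (('i%C : R[i]) *: x) y; rewrite [T _](clinZ _ _ lT) !rdotiE.
move: e1; rewrite /rdot; case: (ip _ _) (ip _ _) => [a b] [c d] /= -> /eqP.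
by rewrite eqr_opp => /eqP ->.
Qed.

(** The real adjoint from the Riesz theorem is a complex adjoint as well, so the choice in [adj] has
    a witness. *)
Lemma adjP T : bop ip T -> is_adjoint ip T (adj ip T).
Proof.
case/bopP => lT bT; rewrite /adj; apply: epsilon_spec.
have [S hS] := adjoint_exists rH bT.
by exists S; apply/is_adjointP.
Qed.

Lemma rdot_adj T x y : bop ip T -> <<T x, y>> = <<x, adj ip T y>>.
Proof. by move=> hT; rewrite /rdot adjP. Qed.

Lemma rdot_adjl T x y : bop ip T -> <<adj ip T x, y>> = <<x, T y>>.
Proof. by move=> hT; rewrite (psd_sym rP) -rdot_adj // (psd_sym rP). Qed.

Lemma ip_ext x y : (forall z, ip z x = ip z y) -> x = y.
Proof.
move=> h; apply: rdot_ext => z; rewrite (psd_sym rP) [RHS](psd_sym rP).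
by rewrite /rdot h.
Qed.

Lemma ipZr a x z : ip z (a *: x) = a^* * ip z x.
Proof. by rewrite ip_conj ipZ rmorphM [ip z x]ip_conj. Qed.

Lemma ipDr x y z : ip z (x + y) = ip z x + ip z y.
Proof. by rewrite ip_conj ipD rmorphD [ip z x]ip_conj [ip z y]ip_conj. Qed.

Lemma hnormZ a x : hnorm ip (a *: x) = `|a| * hnorm ip x.
Proof.
rewrite /hnorm ipZ ipZr mulrA -normCK rootCMl ?exprn_ge0 //.
by rewrite sqrCK.
Qed.

Lemma bop_adj T : bop ip T -> bop ip (adj ip T).
Proof.
move=> hT; have [lT bT] := (bopP T).1 hT; apply/bopP; split.
  move=> a x y; apply: ip_ext => z.
  by rewrite ipDr ipZr -!(adjP hT) ipDr ipZr.
by apply: adjoint_bounded_linear bT _ => // x y; apply: rdot_adj.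
Qed.

Lemma bop_comp T S : bop ip T -> bop ip S -> bop ip (T \o S).
Proof.
move=> /bopP[lT bT] /bopP[lS bS]; apply/bopP.
split; last exact: bounded_linear_comp bT bS.
by move=> a x y /=; rewrite lS lT.
Qed.

Lemma bop_id : bop ip id.
Proof. by apply/bopP; split=> //; apply: bounded_linear_id. Qed.

Lemma bopB T S : bop ip T -> bop ip S -> bop ip (fun x => T x - S x).
Proof.
move=> /bopP[lT bT] /bopP[lS bS]; apply/bopP; split.
  by move=> a x y; rewrite lT lS scalerBr opprD addrACA.
exact: bounded_linearB bT bS.
Qed.

(* Polarization: a complex operator with real quadratic form is self-adjoint. *)
Lemma opnonneg_positive A : bop ip A -> opnonneg ip A <-> pos A.
Proof.
move=> hA; have [lA bA] := (bopP A).1 hA; split=> [h|[_ sA pA]]; last first.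
  move=> x; rewrite lecE /=; apply/andP; split; last exact: pA.
  have /(is_adjointP _ lA) aA := sA.
  have := aA x x; rewrite [RHS]ip_conj conjE; case: (ip _ _) => a b [] /= /eqP.
  by rewrite -subr_eq0 opprK -mulr2n mulrn_eq0 /= => /eqP ->.
have hp x : 0 <= <<A x, x>> by have := h x; rewrite lecE => /andP[].
have him x : complex.Im (ip (A x) x) = 0 by have := h x; rewrite lecE => /andP[/eqP].
split=> // x y; pose j : R[i] := 'i%C.
have := him (j *: x + y); have := him (j *: x); have := him y.
rewrite lA (clinZ _ _ lA) !ipDr !ipZr !ipD !ipZ /rdot [ip x _]ip_conj !conjE /j.
case: (ip (A x) x) (ip (A x) y) (ip (A y) x) (ip (A y) y) => [a b] [c d] [e f] [g k] /=.
lra.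
Qed.

Lemma opsqrtP A : bop ip A -> pos A -> [/\ bop ip (opsqrt ip A),
  pos (opsqrt ip A) & forall x, opsqrt ip A (opsqrt ip A x) = A x].
Proof.
move=> hA pA.
suff [bS [pS SS]] : bop ip (opsqrt ip A) /\ opnonneg ip (opsqrt ip A) /\
    forall x, opsqrt ip A (opsqrt ip A x) = A x.
  by split=> //; apply/opnonneg_positive.
apply: (epsilon_spec (inhabits id)
  (fun B => bop ip B /\ opnonneg ip B /\ forall x, B (B x) = A x)).
have [S [pS SS] cS] := positive_sqrt_exists rH pA.
have bS : bop ip S.
  have [bS _ _] := pS; apply/bopP; split=> // a x y.
  rewrite [LHS](linD bS.1); congr (_ + _); apply/esym.
  (* Complex linearity of the root: multiplication by [a] is bounded, real-linear and commutes with
     [A], hence with the root. *)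
  apply: (cS (fun x : realified V => a *: (x : V))); last first.
    by move=> z; rewrite [RHS](clinZ _ _ (bop_clin hA)).
  split=> [c u v|].
    change (a *: ((c%:C)%C *: (u : V) + v) = (c%:C)%C *: (a *: (u : V)) + a *: (v : V)).
    by rewrite scalerDr !scalerA mulrC.
  exists (Num.sqrt (complex.Re a ^+ 2 + complex.Im a ^+ 2)) => u.
  by rewrite -lecR rmorphM /= -!hnormE hnormZ normc_def.
by exists S; split=> //; split=> //; apply/opnonneg_positive.
Qed.

Lemma opinv_eq A B : bop ip B -> (forall x, B (A x) = x /\ A (B x) = x) ->
  opinv ip A = B.
Proof.
move=> hB BA.
have [_ h] : bop ip (opinv ip A) /\
    forall x, opinv ip A (A x) = x /\ A (opinv ip A x) = x.
  apply: (epsilon_spec (inhabits id)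
    (fun B => bop ip B /\ forall x, B (A x) = x /\ A (B x) = x)).
  by exists B.
by apply/funext => x; rewrite -{1}[x](BA x).2 (h _).1.
Qed.

Lemma closure_rangeE D : closure_range ip D = range_closure (V := realified V) rdot D.
Proof.
apply/funext => y; apply/propext; split=> h e e0.
  have [|x hx] := h (e%:C)%C; first by rewrite ltcR.
  by exists x; move: hx; rewrite hnormE ltcR.
have er : e = ((complex.Re e)%:C)%C.
  by move: e0; case: (e) => a b; rewrite ltcE /= => /andP[/eqP-> _].
have [|x hx] := h (complex.Re e); first by rewrite -ltcR -er.
by exists x; rewrite hnormE er ltcR.
Qed.

Lemma opprojP D x : bop ip D ->
  closure_range ip D (opproj ip (closure_range ip D) x) /\
  forall y, closure_range ip D y ->
    <<x - opproj ip (closure_range ip D) x, y>> = 0.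
Proof.
move=> /bopP[lD bD]; set M := closure_range ip D.
suff h : forall x, M (opproj ip M x) /\ forall y, M y -> ip (x - opproj ip M x) y = 0.
  split=> [|y My]; first by case: (h x).
  by rewrite /rdot (h x).2.
apply: (epsilon_spec (inhabits id)
  (fun P => forall x, M (P x) /\ forall y, M y -> ip (x - P x) y = 0)).
have [M0 MD] := range_closure_subspace rH bD.1.
have /boolp.choice[P hP] : forall x, exists p, M p /\ forall y, M y -> <<x - p, y>> = 0.
  move=> u; have [p Mp hp] := projection_exists rH u (conj M0 MD)
    (@range_closure_closed _ _ _ rH D).
  by exists p; rewrite /M closure_rangeE.
exists P => u; have [Mu hu] := hP u; split=> // y My.
(* The closure of the range is stable under i, so real orthogonality to [y] and to iy kills both
   parts of the complex inner product. *)
have Miy : M (('i%C : R[i]) *: y).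
  move: My; rewrite /M => My e e0; have [z hz] := My e e0.
  exists (('i%C : R[i]) *: z); rewrite (clinZ _ _ lD) -scalerBr hnormZ.
  by rewrite normc_def /= expr0n expr1n add0r sqrtr1 mul1r.
have := hu _ My; have := hu _ Miy; rewrite /rdot ipZr conjE.
by case: (ip _ _) => a b /=; rewrite mul0r sub0r mulN1r opprK => -> ->.
Qed.

Lemma ipN x z : ip (- x) z = - ip x z.
Proof. by rewrite -scaleN1r ipZ mulN1r. Qed.

Lemma ip_adjl T x y : bop ip T -> ip (adj ip T x) y = ip x (T y).
Proof. by move=> hT; rewrite ip_conj -adjP // -ip_conj. Qed.

Lemma rdotB x y z : <<x - y, z>> = <<x, z>> - <<y, z>>.
Proof. by rewrite [LHS](psdDl rP) (psdNl rP). Qed.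

Lemma concaveE T : bop ip T -> concave ip T <->
  forall x, <<T (T x), T (T x)>> - 2 * <<T x, T x>> + <<x, x>> <= 0.
Proof.
move=> hT.
have e x : ip (0 - (adj ip T (adj ip T (T (T x))) - 2%:R *: adj ip T (T x) + x)) x =
    ((- (<<T (T x), T (T x)>> - 2 * <<T x, T x>> + <<x, x>>))%:C)%C.
  rewrite sub0r ipN !ipD ipN ipZ !ip_adjl // !ip_self.
  by rewrite !(rmorphN, rmorphD, rmorphM, rmorph_nat).
by split=> h x; have := h x; rewrite ?e ler0c oppr_ge0.
Qed.

Lemma hypercontraction2E C : bop ip C -> hypercontraction2 ip C <->
  (forall x, <<C x, C x>> <= <<x, x>>) /\
  (forall x, 0 <= <<x, x>> - 2 * <<C x, C x>> + <<C (C x), C (C x)>>).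
Proof.
move=> hC; have e1 x : ip (x - adj ip C (C x)) x = ((<<x, x>> - <<C x, C x>>)%:C)%C.
  by rewrite ipD ipN ip_adjl // !ip_self rmorphB.
have e2 x : ip (x - 2%:R *: adj ip C (C x) + adj ip C (adj ip C (C (C x)))) x =
    ((<<x, x>> - 2 * <<C x, C x>> + <<C (C x), C (C x)>>)%:C)%C.
  rewrite !ipD ipN ipZ !ip_adjl // !ip_self.
  by rewrite !(rmorphN, rmorphD, rmorphM, rmorph_nat).
split=> -[h1 h2]; split=> x.
- by have := h1 x; rewrite e1 ler0c subr_ge0.
- by have := h2 x; rewrite e2 ler0c.
- by rewrite e1 ler0c subr_ge0.
- by rewrite e2 ler0c.
Qed.

(** * Gram operators and the Cauchy dual *)

Definition gram T : V -> V := fun x => adj ip T (T x).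

Lemma bop_gram T : bop ip T -> bop ip (gram T).
Proof. by move=> hT; apply: bop_comp (bop_adj hT) hT. Qed.

Lemma gram_positive T : bop ip T -> pos (gram T).
Proof.
move=> hT; split; first exact: bop_blin (bop_gram hT).
  by move=> x y; rewrite /gram rdot_adjl // rdot_adj.
by move=> x; rewrite /gram rdot_adjl //; apply: (psd_ge0 rP).
Qed.

(** If B inverts A = T^*T, then C = TB has C^*C = BAB = B, and dualizing again gives TBA = T. A
    general [c] covers expansive operators and left invertible ones alike. *)
Lemma cdualP T (c : R) : bop ip T -> 0 < c ->
  (forall x, c * <<x, x>> <= <<T x, T x>>) -> let C := cdual ip T in
  [/\ bop ip C, forall x, gram T (gram C x) = x, forall x, gram C (gram T x) = x,
     forall x, C x = T (gram C x) & cdual ip C = T].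
Proof.
move=> hT c0 cT; have hA := bop_gram hT; have [bA sA _] := gram_positive hT.
have [|B bB BA] := coercive_inverse rH bA sA c0.
  by move=> x; rewrite /gram rdot_adjl.
have hB : bop ip B.
  apply/bopP; split=> // a x y.
  by rewrite -[RHS](BA _).1 (bop_clin hA) !(BA _).2.
have defC : cdual ip T = T \o B by rewrite /cdual (opinv_eq hB BA).
have hC : bop ip (cdual ip T) by rewrite defC; apply: bop_comp.
have gC x : gram (cdual ip T) x = B x.
  apply: rdot_ext => z; rewrite /gram rdot_adjl // defC /= rdot_adj //.
  by rewrite [adj ip T (T (B z))](BA z).2.
rewrite /=; split=> // [x|x|x|]; rewrite ?gC ?(BA x).1 ?(BA x).2 ?defC //.
apply/funext => x; rewrite /cdual -defC.
have -> : (fun x => adj ip (cdual ip T) (cdual ip T x)) = B.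
  by apply/funext => y; apply: gC.
have -> : opinv ip B = gram T by apply: opinv_eq => // y; case: (BA y).
by rewrite defC /= (BA x).1.
Qed.

Section DualPair.
Variables T C : V -> V.
Hypotheses (hT : bop ip T) (hC : bop ip C).
Hypotheses (AB : forall x, gram T (gram C x) = x).
Hypotheses (BA : forall x, gram C (gram T x) = x).
Hypothesis CT : forall x, C x = T (gram C x).
Hypothesis expT : forall x, <<x, x>> <= <<T x, T x>>.

Let TC x : T x = C (gram T x). Proof. by rewrite CT BA. Qed.

(** From A <= A^2 at the vector Bx, since AB = 1. *)
Let conC x : <<C x, C x>> <= <<x, x>>.
Proof.
have h : forall x, <<x, x>> <= <<gram T x, x>> by move=> y; rewrite /gram rdot_adjl.
have := ge1_sqr rH h (gram C x); rewrite AB; apply: le_trans.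
by rewrite rdot_adj.
Qed.

Let hDelta : bop ip (Delta ip T). Proof. exact: bopB (bop_gram hT) bop_id. Qed.

Let pDelta : pos (Delta ip T).
Proof.
have [_ sA _] := gram_positive hT; split; first exact: bop_blin.
  move=> x y; rewrite /Delta rdotB [RHS](psd_sym rP) rdotB [<<x, y>>](psd_sym rP).
  by rewrite [X in X - _]sA (psd_sym rP).
by move=> x; rewrite rdotB rdot_adjl // subr_ge0.
Qed.

Let hDC : bop ip (fun x => x - gram C x). Proof. exact: bopB bop_id (bop_gram hC). Qed.

Let pDC : pos (fun x => x - gram C x).
Proof.
have [_ sB _] := gram_positive hC; split; first exact: bop_blin.
  move=> x y; rewrite rdotB [RHS](psd_sym rP) rdotB [<<x, y>>](psd_sym rP).
  by rewrite [X in _ - X]sB (psd_sym rP x).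
by move=> x; rewrite rdotB rdot_adjl // subr_ge0.
Qed.

Let Q := opsqrt ip (Delta ip T).
Let D := defect ip C.

Let hQ : [/\ bop ip Q, pos Q & forall x, Q (Q x) = Delta ip T x].
Proof. exact: opsqrtP. Qed.

Let hD : [/\ bop ip D, pos D & forall x, D (D x) = x - gram C x].
Proof. exact: opsqrtP hDC pDC. Qed.

Let P := opproj ip (closure_range ip D).

Let hP x : range_closure (V := realified V) rdot D (P x) /\
  forall y, range_closure (V := realified V) rdot D y -> <<x - P x, y>> = 0.
Proof. by case: hD => bD _ _; have := opprojP x bD; rewrite -closure_rangeE. Qed.

Let QE y : <<Q y, Q y>> = <<T y, T y>> - <<y, y>>.
Proof.
by case: hQ => _ [_ sQ _] QQ; rewrite -[LHS]sQ QQ rdotB rdot_adjl.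
Qed.

Let DE y : <<D y, D y>> = <<y, y>> - <<C y, C y>>.
Proof.
by case: hD => _ [_ sD _] DD; rewrite -[LHS]sD DD rdotB rdot_adjl.
Qed.

Lemma regularE : regular ip (Delta ip T) T <->
  commutes (V := realified V) (Q \o T) Q.
Proof.
by case: hQ => _ _ QQ; split=> h x; have := h x; rewrite /= -?/Q QQ => ->.
Qed.

Lemma defect_regularE : defect_regular ip C <->
  commutes (V := realified V) (D \o C) D.
Proof. by split=> h x; exact: esym (h x). Qed.

Lemma concave_normE : concave ip T <-> forall x, nm (Q (T x)) <= nm (Q x).
Proof.
split.
  move=> /(concaveE hT) h x; rewrite (nrm_le_sqr rH) !QE; have := h x; lra.
move=> h; apply/(concaveE hT) => x; have := h x; rewrite (nrm_le_sqr rH) !QE; lra.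
Qed.

(** As B is a contraction, |DCx| <= |Dx|, which expands to the second-order inequality. *)
Lemma defect_norm_hypercontraction2 :
  (forall x, nm (D (C x)) <= nm (gram C (D x))) -> hypercontraction2 ip C.
Proof.
move=> h; apply/(hypercontraction2E hC); split=> // x.
have pB := gram_positive hC.
have cB : nm (gram C (D x)) <= nm (D x).
  apply: (positive_contraction rH pB) => y.
  by rewrite /gram rdot_adjl.
have := le_trans (h x) cB; rewrite (nrm_le_sqr rH) !DE; lra.
Qed.

(** The hypotheses only relate [T] and [C], so the equivalence can be used whichever of the two is
    constructed from the other. *)
Lemma dual_pair_equiv :
  regular ip (Delta ip T) T /\ concave ip T <->
  [/\ hypercontraction2 ip C, defect_regular ip C &
     forall h, closure_range ip D h -> hnorm ip (P (C h)) <= hnorm ip (gram C h)].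
Proof.
have [bQ pQ QQ] := hQ; have [bD pD DD] := hD; have pB := gram_positive hC.
have bA := bop_blin (bop_gram hT); have bB := bop_blin (bop_gram hC).
split=> [[/regularE rT /concave_normE cT]|[_ /defect_regularE rC nC]].
  have rC := regular_defect rH (bop_blin hT) bA pB AB BA CT pQ QQ pD DD rT.
  have nC := regular_defect_norm rH (bop_blin hT) bA pB AB BA CT pQ QQ pD DD rT cT.
  split; [exact: defect_norm_hypercontraction2 | exact/defect_regularE |].
  move=> h; rewrite closure_rangeE !hnormE lecR.
  exact: (projection_defect_norm rH pD (bop_blin hC) bB rC hP nC).
(* The norm condition at [D x], rewritten by [projection_defect]. *)
have nC' x : nm (D (C x)) <= nm (gram C (D x)).
  have := nC (D x); rewrite closure_rangeE !hnormE lecR.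
  rewrite (projection_defect rH pD rC hP); apply.
  exact: range_closure_range.
split; first by apply/regularE;
  exact: (defect_regular_Delta rH (bop_blin hC) bA pB AB BA TC pQ QQ pD DD rC).
apply/concave_normE.
exact: (defect_regular_Delta_norm rH (bop_blin hC) bA pB AB BA TC pQ QQ pD DD rC nC').
Qed.

End DualPair.

(** * The bijection *)

Lemma left_invertible_coercive C : bop ip C -> left_invertible ip C ->
  exists2 c : R, 0 < c & forall x, c * <<x, x>> <= <<C x, C x>>.
Proof.
move=> hC [L [hL LC]]; have [M M0 hM] := bounded_linear_gt0 (bop_blin hL).
exists (M ^+ 2)^-1 => [|x]; first by rewrite invr_gt0 exprn_gt0.
rewrite ler_pdivrMl ?exprn_gt0 // -!(nrm_sqr rH) -exprMn.
by rewrite ler_pXn2r ?nnegrE ?mulr_ge0 ?nrm_ge0 ?(ltW M0) // -{1}[x]LC.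
Qed.

End ComplexHilbert.

Theorem theorem3p1 (R : realType) (V : lmodType R[i]) (ip : V -> V -> R[i])
    (HH : hilbert ip) :
  let S1 := fun T : V -> V =>
    [/\ bop ip T, regular ip (Delta ip T) T & concave ip T] in
  let S2 := fun C : V -> V =>
    [/\ bop ip C, left_invertible ip C, hypercontraction2 ip C,
        defect_regular ip C &
        forall h, closure_range ip (defect ip C) h ->
          hnorm ip (opproj ip (closure_range ip (defect ip C)) (C h))
            <= hnorm ip (adj ip C (C h))] in
  [/\ (forall T, S1 T -> S2 (cdual ip T)),
      (forall T1 T2, S1 T1 -> S1 T2 -> cdual ip T1 = cdual ip T2 -> T1 = T2) &
      (forall C, S2 C -> exists T, S1 T /\ cdual ip T = C)].
Proof.
move=> S1 S2; have rH := rdot_hilbert HH.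
have expS1 T : S1 T -> forall x, rdot ip x x <= rdot ip (T x) (T x).
  by case=> hT _ /(concaveE HH hT) cT; apply: (concave_expansive rH).
have exp1S1 T : S1 T -> forall x, 1 * rdot ip x x <= rdot ip (T x) (T x).
  by move=> hT x; rewrite mul1r; apply: expS1.
split=> [T sT|T1 T2 s1 s2 e|C [hC lC hypC rC nC]].
- have [hT rT cT] := sT.
  have [hC AB BA CT _] := cdualP HH hT ltr01 (exp1S1 T sT).
  have [] := (dual_pair_equiv HH hT hC AB BA CT (expS1 T sT)).1 (conj rT cT).
  (* The left inverse is the adjoint of T, since T^*C = T^*TB = 1. *)
  split=> //; exists (adj ip T); split; first exact: bop_adj.
  by move=> x; rewrite CT; apply: AB.
- have [h1 _ _] := s1; have [h2 _ _] := s2.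
  (* Injectivity: each operator is the dual of its dual. *)
  have [_ _ _ _ <-] := cdualP HH h1 ltr01 (exp1S1 T1 s1).
  have [_ _ _ _ <-] := cdualP HH h2 ltr01 (exp1S1 T2 s2).
  by rewrite e.
(* Surjectivity: [C] is bounded below, so its own Cauchy dual exists and is the preimage. *)
have [c c0 cC] := left_invertible_coercive HH hC lC.
have [hT BA AB TC eC] := cdualP HH hC c0 cC.
exists (cdual ip C); split=> //.
have [conC _] := (hypercontraction2E HH hC).1 hypC.
have CT x : C x = cdual ip C (gram ip C x) by rewrite TC AB.
have expT x : rdot ip x x <= rdot ip (cdual ip C x) (cdual ip C x).
  have h y : rdot ip (gram ip C y) y <= rdot ip y y.
    by rewrite /gram rdot_adjl.
  (* B^2 <= B at the vector Ax reads <x, x> <= <x, Ax> = |Tx|^2. *)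
  have := positive_le1_sqr rH (gram_positive HH hC) h (gram ip (cdual ip C) x).
  by rewrite BA -rdot_adj.
by have [] := (dual_pair_equiv HH hT hC AB BA CT expT).2 (And3 hypC rC nC).
Qed.
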